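(* Let $(G,\tau_G)$ be a topological group and let $(X,d)$ be a metric space endowed with a continuous action of $G$. Assume that for every $g\in G$ the homeomorphism $X\to X$, $x\mapsto gx$, is uniformly continuous on $X$. If $\tau_G$ contains the topology of uniform convergence, then the induced action $(g,A)\mapsto gA=\{ga: a\in A\}$ of $G$ on $\mathrm{CL}(X)$ is continuous when $\mathrm{CL}(X)$ is equipped with the lower Hausdorff topology, with the upper Hausdorff topology, and with the Hausdorff metric topology.
   Context: $\mathrm{CL}(X)$ denotes the family of all nonempty closed subsets of $X$. For $A,B\subset X$ nonempty, the excess of $A$ over $B$ is $e(A,B)=\sup\{d(a,B): a\in A\}\in[0,\infty]$, where $d(a,B)=\inf_{b\in B}d(a,b)$. Set $d_{H^-}(A,C)=e(A,C)$, $d_{H^+}(A,C)=e(C,A)$ and $d_H(A,C)=\max\{e(A,C),e(C,A)\}$ for $A,C\in\mathrm{CL}(X)$ (these may take the value $\infty$). The lower Hausdorff, upper Hausdorff and Hausdorff metric topologies on $\mathrm{CL}(X)$ are generated by the quasi-pseudometrics $d_{H^-}$, $d_{H^+}$ and the (extended) metric $d_H$, respectively; basic neighborhoods of $A$ are the balls $\{C:\rho(A,C)<\varepsilon\}$, $\varepsilon>0$, with $\rho$ the corresponding function. The topology of uniform convergence on $G$ is the topology generated by all sets $\{h\in G: d(gx,hx)<\varepsilon\ \text{for all } x\in X\}$, where $g\in G$ and $\varepsilon>0$. *)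

(* Defs.v *)
From HB Require Import structures.
From mathcomp Require Import all_boot all_order all_algebra.
From mathcomp Require Import all_classical all_reals all_analysis.

Set Implicit Arguments.
Unset Strict Implicit.
Unset Printing Implicit Defensive.
Import Order.TTheory GRing.Theory Num.Theory.
Local Open Scope classical_set_scope.
Local Open Scope ring_scope.

HB.mixin Record isTopologicalGroup G & Group G & Topological G := {
  mulg_continuous : continuous (fun p : G * G => (p.1 * p.2)%g) ;
  invg_continuous : continuous (fun g : G => (g^-1)%g)
}.

#[short(type="topologicalGroupType")]
HB.structure Definition TopologicalGroup :=
  {G of Group G & Topological G & isTopologicalGroup G}.

Record is_action (G : groupType) (T : Type) (act : G -> T -> T) : Prop := {
  action1 : forall x, act 1%g x = x ;
  actionM : forall g h x, act (g * h)%g x = act g (act h x)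
}.

Record continuous_action (G : topologicalGroupType) (T : topologicalType)
    (act : G -> T -> T) : Prop := {
  continuous_action_action : is_action act ;
  continuous_action_continuous : continuous (fun p : G * T => act p.1 p.2)
}.

Definition uniform_ball (R : realType) (G : groupType) (X : metricType R)
    (act : G -> X -> X) (g : G) (e : R) : set G :=
  [set h | forall x, mdist (act g x) (act h x) < e].

(* G, with the topology having the sets [uniform_ball act g e] as a subbase. *)
Definition uniform_convergence (R : realType) (G : groupType)
  (X : metricType R) (act : G -> X -> X) : Type := G.

Section UniformConvergence.
Context (R : realType) (G : groupType) (X : metricType R) (act : G -> X -> X).

HB.instance Definition _ := Choice.copy (uniform_convergence act) G.
HB.instance Definition _ :=
  isSubBaseTopological.Build (uniform_convergence act)
    [set U : set G | exists g e, 0 < e /\ U = uniform_ball act g e] id.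

End UniformConvergence.

Section QuasiPseudoMetric.
Local Open Scope ereal_scope.

Record quasi_pseudo_metric (R : realType) (T : Type) := QuasiPseudoMetric {
  qdist :> T -> T -> \bar R ;
  qdist_ge0 : forall x y, 0 <= qdist x y ;
  qdistxx : forall x, qdist x x = 0 ;
  qdist_triangle : forall y x z, qdist x z <= qdist x y + qdist y z
}.

(* T, with the topology whose basic neighborhoods are the balls of [rho]. *)
Definition qdist_space (R : realType) (T : Type)
  (rho : quasi_pseudo_metric R T) : Type := T.

Context (R : realType) (T : Type) (rho : quasi_pseudo_metric R T).
Local Notation space := (qdist_space rho).

Definition qdist_nbhs (x : space) : set_system space :=
  filter_from [set e : R | (0 < e)%R] (fun e => [set y | rho x y < e%:E]).

Lemma qdist_nbhs_filter x : ProperFilter (qdist_nbhs x).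
Proof.
apply: filter_from_proper; last first.
  by move=> e e0; exists x => /=; rewrite qdistxx lte_fin.
apply: filter_from_filter; first by exists 1%R => /=.
move=> e f e0 f0; exists (Num.min e f); first by rewrite /= lt_min e0.
by move=> y /=; rewrite EFin_min lt_min => /andP.
Qed.

Lemma qdist_nbhs_singleton x (A : set space) : qdist_nbhs x A -> A x.
Proof. by case=> e e0; apply => /=; rewrite qdistxx lte_fin. Qed.

Lemma qdist_nbhs_nbhs x (A : set space) :
  qdist_nbhs x A -> qdist_nbhs x (qdist_nbhs^~ A).
Proof.
case=> e /= e0 eA; have e2 : (0 < e / 2)%R by rewrite divr_gt0.
exists (e / 2)%R => // y /= xy; exists (e / 2)%R => // z /= yz.
apply: eA => /=; apply: (le_lt_trans (qdist_triangle rho y x z)).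
by rewrite [in ltRHS](splitr e) EFinD lteD.
Qed.

HB.instance Definition _ := gen_eqMixin space.
HB.instance Definition _ := gen_choiceMixin space.
HB.instance Definition _ := hasNbhs.Build space qdist_nbhs.
HB.instance Definition _ := Nbhs_isNbhsTopological.Build space
  qdist_nbhs_filter qdist_nbhs_singleton qdist_nbhs_nbhs.

End QuasiPseudoMetric.

Record CL (X : topologicalType) := MkCL {
  CL_set :> set X ;
  CL_closed : closed CL_set ;
  CL_nonempty : CL_set !=set0
}.

Section Hausdorff.
Local Open Scope ereal_scope.
Context (R : realType) (X : metricType R).
Implicit Types (A B C : set X).

Definition dist_set (x : X) B : \bar R := ereal_inf [set (mdist x b)%:E | b in B].

Definition excess A B : \bar R := ereal_sup [set dist_set a B | a in A].

Lemma dist_set_ge0 x B : 0 <= dist_set x B.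
Proof. by apply: le_ereal_inf_tmp => _ [b _ <-]; rewrite lee_fin mdist_ge0. Qed.

Lemma excess_ge0 A B : A !=set0 -> 0 <= excess A B.
Proof.
case=> a Aa; apply: le_trans (dist_set_ge0 a B) _.
by apply: ereal_sup_ubound; exists a.
Qed.

Lemma excessxx A : A !=set0 -> excess A A = 0.
Proof.
move=> A0; apply/eqP; rewrite eq_le excess_ge0// andbT.
apply: ge_ereal_sup => _ [a Aa <-].
by apply: ereal_inf_lbound; exists a => //; rewrite mdistxx.
Qed.

Lemma excess_triangle B A C : A !=set0 -> B !=set0 ->
  excess A C <= excess A B + excess B C.
Proof.
move=> A0 B0; apply: ge_ereal_sup => _ [a Aa <-].
have [->|ABy] := eqVneq (excess A B) +oo.
  by rewrite addye ?leey// gt_eqF// (lt_le_trans _ (excess_ge0 _ B0)).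
have ABf : excess A B \is a fin_num by rewrite ge0_fin_numE ?excess_ge0// ltey.
apply/lee_addgt0Pr => e e0.
have aB : dist_set a B < excess A B + e%:E.
  apply: (@le_lt_trans _ _ (excess A B)); last by rewrite lteDl.
  by apply: ereal_sup_ubound; exists a.
have [_ [b Bb <-] ab] := ereal_inf_lt aB.
have bC : dist_set b C <= excess B C by apply: ereal_sup_ubound; exists b.
rewrite addeAC; apply: le_trans (leeD (ltW ab) bC).
rewrite -leeBlDl//; apply: le_ereal_inf_tmp => _ [c Cc <-].
rewrite leeBlDl// -EFinD; apply: (@le_trans _ _ (mdist a c)%:E).
  by apply: ereal_inf_lbound; exists c.
by rewrite lee_fin metric_triangle.
Qed.

Definition lower_hausdorff_dist (A C : CL X) : \bar R := excess A C.
Definition upper_hausdorff_dist (A C : CL X) : \bar R := excess C A.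
Definition hausdorff_dist (A C : CL X) : \bar R :=
  maxe (excess A C) (excess C A).

Definition lower_hausdorff : quasi_pseudo_metric R (CL X).
Proof.
apply: (@QuasiPseudoMetric _ _ lower_hausdorff_dist) => [A B|A|B A C].
- exact/excess_ge0/CL_nonempty.
- exact/excessxx/CL_nonempty.
- by apply: excess_triangle; exact: CL_nonempty.
Defined.

Definition upper_hausdorff : quasi_pseudo_metric R (CL X).
Proof.
apply: (@QuasiPseudoMetric _ _ upper_hausdorff_dist) => [A B|A|B A C].
- exact/excess_ge0/CL_nonempty.
- exact/excessxx/CL_nonempty.
- by rewrite addeC; apply: excess_triangle; exact: CL_nonempty.
Defined.

Definition hausdorff : quasi_pseudo_metric R (CL X).
Proof.
apply: (@QuasiPseudoMetric _ _ hausdorff_dist) => [A B|A|B A C].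
- by rewrite le_max excess_ge0//; exact: CL_nonempty.
- by rewrite /hausdorff_dist maxxx; exact/excessxx/CL_nonempty.
- have [[A0 B0] C0] := (CL_nonempty A, CL_nonempty B, CL_nonempty C).
  rewrite /hausdorff_dist ge_max; apply/andP; split.
  + by apply: le_trans (excess_triangle C A0 B0) _; apply: leeD; rewrite le_max lexx ?orbT.
  + apply: le_trans (excess_triangle A C0 B0) _.
    by rewrite addeC; apply: leeD; rewrite le_max lexx ?orbT.
Defined.

End Hausdorff.
Arguments lower_hausdorff {R} X.
Arguments upper_hausdorff {R} X.
Arguments hausdorff {R} X.

Section InducedAction.
Context (G : topologicalGroupType) (X : topologicalType) (act : G -> X -> X).
Hypothesis hact : continuous_action act.

Lemma continuous_act g : continuous (act g).
Proof.
move=> x; apply: (@continuous_comp _ _ _ (fun y => (g, y))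
    (fun p : G * X => act p.1 p.2)); last exact: continuous_action_continuous.
by apply: cvg_pair; [exact: cvg_cst|exact: cvg_id].
Qed.

Lemma image_act_closed g (A : set X) : closed A -> closed (act g @` A).
Proof.
have [act1 actM] := continuous_action_action hact.
move=> Acl; suff -> : act g @` A = act g^-1%g @^-1` A.
  by apply: preimage_closed => // x _; exact: continuous_act.
apply/seteqP; split=> [_ [a Aa <-]|x Ax] /=.
  by rewrite -actM mulVg act1.
by exists (act g^-1%g x) => //; rewrite -actM mulgV act1.
Qed.

Definition CL_act (g : G) (A : CL X) : CL X :=
  MkCL (@image_act_closed g A (@CL_closed _ A))
       (image_nonempty (act g) (CL_nonempty A)).

End InducedAction.

(* Main.v *)
(* If [h] is uniformly within [e/3] of [g], and [d] is a modulus of uniform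
   continuity of [g] for [e/3], then [d(a,c) < d] forces
   [d(ga,hc) <= d(ga,gc) + d(gc,hc) < 2e/3]. Hence both excesses between [gA]
   and [hC] are controlled by the corresponding excesses between [A] and [C],
   uniformly in the sets. *)
Require Import Defs.
From HB Require Import structures.
From mathcomp Require Import all_boot all_order all_algebra.
From mathcomp Require Import all_classical all_reals all_analysis.
From mathcomp Require Import lra.

Local Open Scope classical_set_scope.
Local Open Scope ring_scope.

Import Order.TTheory GRing.Theory Num.Theory.

Lemma CL_eq (X : topologicalType) (A B : CL X) :
  CL_set A = CL_set B -> A = B.
Proof.
case: A B => [A clA A0] [B clB B0] /= AB; rewrite -{}AB in clB B0 *.
by congr MkCL; exact: Prop_irrelevance.
Qed.

Lemma CL_act_is_action (G : topologicalGroupType) (X : topologicalType)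
    (act : G -> X -> X) (hact : continuous_action act) :
  is_action (CL_act hact).
Proof.
have [act1 actM] := continuous_action_action hact.
split=> [A|g h A]; apply: CL_eq => /=.
  by rewrite (eq_imagel (f' := id)) ?image_id.
by rewrite image_comp; apply: eq_imagel => x _; exact: actM.
Qed.

Lemma open_uniform_ball (R : realType) (G : groupType) (X : metricType R)
    (act : G -> X -> X) (g : G) (e : R) : 0 < e ->
  open (uniform_ball act g e : set (uniform_convergence act)).
Proof.
move=> e0; exists [set uniform_ball act g e]; last by rewrite bigcup_set1.
by move=> _ ->; apply: finI_from1; exists g, e.
Qed.

(** A strict excess gives each [a] of [A] some [b] of [B] at distance below [d], and [k b] then
    bounds the distance from [f a]. Two maps allow [g] and [h] to act on different sides. *)
Lemma excess_image_le (R : realType) (X : metricType R) (f k : X -> X)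
    (A B : set X) (d r : R) :
  (forall x y, mdist x y < d -> mdist (f x) (k y) <= r) ->
  (excess A B < d%:E)%E -> (excess (f @` A) (k @` B) <= r%:E)%E.
Proof.
move=> fk AB; apply: ge_ereal_sup => _ [_ [a Aa <-] <-].
have aB : (dist_set a B < d%:E)%E.
  by apply: le_lt_trans AB; apply: ereal_sup_ubound; exists a.
have [_ [b Bb <-]] := ereal_inf_lt aB; rewrite lte_fin => ab.
apply: (@le_trans _ _ (mdist (f a) (k b))%:E); last by rewrite lee_fin fk.
by apply: ereal_inf_lbound; exists (k b) => //; exists b.
Qed.

Section InducedActionContinuity.
Context (R : realType) (G : topologicalGroupType) (X : metricType R).
Context (act : G -> X -> X) (hact : continuous_action act).
Hypothesis hunif : forall g : G, unif_continuous (act g).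
Hypothesis htop :
  forall U : set G, open (U : set (uniform_convergence act)) -> open U.

(** This is where [htop] enters: a uniform ball is subbasic for uniform convergence, hence open in
    [G]. *)
Lemma nbhs_uniform_ball (g : G) (e : R) : 0 < e -> nbhs g (uniform_ball act g e).
Proof.
move=> e0; apply: open_nbhs_nbhs; split.
  by apply: htop; exact: open_uniform_ball.
by move=> x; rewrite mdistxx.
Qed.

Lemma act_modulus (g : G) (e : R) : 0 < e ->
  exists2 d, 0 < d & forall x y, mdist x y < d -> mdist (act g x) (act g y) < e.
Proof.
(* Entourages are rewritten through balls, so that the one given by radius [e] can be tested. *)
move=> e0; have := hunif g; rewrite /unif_continuous -!entourage_ballE.
case/(_ [set xy | ball xy.1 e xy.2]); first by exists e.
move=> d /= d0 dsub; exists d => // x y xy.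
by have := dsub (x, y); rewrite /= !ballEmdist; exact.
Qed.

(** The modulus [d] comes from [g] alone, so it serves all nearby [h] and all sets at once. Both
    orders are recorded because the upper distance reverses the excess and puts [act h] on the first
    set. *)
Lemma excess_act_close (g : G) (e : R) : 0 < e ->
  exists2 d, 0 < d & \forall h \near g, forall A B : set X,
    (excess A B < d%:E)%E ->
    (excess (act g @` A) (act h @` B) < e%:E)%E /\
    (excess (act h @` A) (act g @` B) < e%:E)%E.
Proof.
move=> e0; have e3 : 0 < e / 3 by rewrite divr_gt0.
have [d d0 gd] := act_modulus g _ e3; exists d => //.
have gh h x y : uniform_ball act g (e / 3) h -> mdist x y < d ->
    mdist (act g x) (act h y) <= e / 3 + e / 3.
  move=> hg xy; apply: le_trans (metric_triangle _ (act g y) _) _.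
  by apply: lerD; apply: ltW; [exact: gd|exact: hg].
have e3e : ((e / 3 + e / 3)%:E < e%:E)%E by rewrite lte_fin; lra.
apply: filterS (nbhs_uniform_ball g _ e3) => h hg A B AB.
split; apply: le_lt_trans e3e; apply: excess_image_le AB => x y xy.
  exact: gh.
by rewrite metric_sym; apply: gh; rewrite // metric_sym.
Qed.

Lemma CL_act_continuous_action (rho : quasi_pseudo_metric R (CL X)) :
  (forall (g : G) (e : R), 0 < e -> exists2 d, 0 < d & \forall h \near g, forall A B,
    (rho A B < d%:E)%E -> (rho (CL_act hact g A) (CL_act hact h B) < e%:E)%E) ->
  continuous_action
    (CL_act hact : G -> qdist_space rho -> qdist_space rho).
Proof.
move=> rho_close; split; first exact: CL_act_is_action.
move=> [g A] U [e e0 eU]; have [d d0 gd] := rho_close g e e0.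
(* The product of a neighbourhood of [g] and the [d]-ball about [A] is sent into the [e]-ball about
   [gA]. *)
exists ([set h | forall A B, (rho A B < d%:E)%E ->
    (rho (CL_act hact g A) (CL_act hact h B) < e%:E)%E],
  [set B | (rho A B < d%:E)%E]).
  by split=> //=; exists d.
by move=> [h B] [/= hg AB]; apply: eU => /=; exact: hg.
Qed.

End InducedActionContinuity.

Theorem theorem4p8 (R : realType) (G : topologicalGroupType) (X : metricType R)
    (act : G -> X -> X) (hact : continuous_action act)
    (hunif : forall g : G, unif_continuous (act g))
    (htop : forall U : set G, open (U : set (uniform_convergence act)) -> open U) :
  [/\ continuous_action (CL_act hact :
        G -> qdist_space (lower_hausdorff X) -> qdist_space (lower_hausdorff X)),
      continuous_action (CL_act hact :
        G -> qdist_space (upper_hausdorff X) -> qdist_space (upper_hausdorff X))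
    & continuous_action (CL_act hact :
        G -> qdist_space (hausdorff X) -> qdist_space (hausdorff X))].
Proof.
split; apply: CL_act_continuous_action => g e e0;
  have [d d0 gd] := excess_act_close _ _ _ _ hunif htop g e e0; exists d => //;
  apply: filterS gd => h gh A B.
(* The lower distance uses the first half of [gh] at [(A, B)], the upper one the second half at
   [(B, A)], and the Hausdorff distance both. *)
- by move=> /gh[].
- by move=> /gh[].
- by rewrite /= /hausdorff_dist !gt_max => /andP[/gh[-> _] /gh[_ ->]].
Qed.
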